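(* Let $n\ge 3$. Any dihedral subgroup $\mathrm{D}_{2n}$ of order $2n$ in $\mathrm{PGL}_3(\mathbb{C})$ is $\mathrm{PGL}_3(\mathbb{C})$-conjugate to $\langle B,A\rangle$, where $B=[X:Z:Y]$ and $A=\mathrm{diag}(1,\zeta_n^a,\zeta_n^{-a})$ for some integer $a$ with $\gcd(n,a)=1$. Moreover, it can always be descended to $\mathbb{R}$: there exist $\alpha,\beta\in\mathbb{C}^*$ such that, with $\phi\in\mathrm{PGL}_3(\mathbb{C})$ the class of $\begin{pmatrix}1&0&0\\0&\alpha&\beta\\0&\overline{\alpha}&\overline{\beta}\end{pmatrix}$, the group $\langle \phi^{-1}B\phi,\ \phi^{-1}A\phi\rangle$ is a model over $\mathbb{R}$, where, in $\mathrm{PGL}_3(\mathbb{C})$, $$\phi^{-1}A\,\phi=\begin{pmatrix} 2\,\mathrm{Im}(\alpha\overline{\beta}) & 0 & 0\\ 0 & 2\,\mathrm{Im}(\alpha\overline{\beta}\,\zeta_n^{a}) & 2|\beta|^2\sin(2\pi a/n)\\ 0 & -2|\alpha|^2\sin(2\pi a/n) & 2\,\mathrm{Im}(\alpha\overline{\beta}\,\zeta_n^{-a})\end{pmatrix}$$ and $$\phi^{-1}B\,\phi=\begin{pmatrix} 2\,\mathrm{Im}(\alpha\overline{\beta}) & 0 & 0\\ 0 & -2\,\mathrm{Im}(\alpha\beta) & -2\,\mathrm{Im}(\beta^2)\\ 0 & 2\,\mathrm{Im}(\alpha^2) & 2\,\mathrm{Im}(\alpha\beta)\end{pmatrix}.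$$
   Context: Here $\zeta_n=e^{2\pi i/n}$. A matrix in $\mathrm{GL}_3(\mathbb{C})$ is identified with its class in $\mathrm{PGL}_3(\mathbb{C})$; $[X:Z:Y]$ denotes the class of the permutation matrix $\begin{pmatrix}1&0&0\\0&0&1\\0&1&0\end{pmatrix}$. A model over $\mathbb{R}$ for a finite subgroup $G\subset\mathrm{PGL}_3(\mathbb{C})$ is a subgroup $G'\subset\mathrm{PGL}_3(\mathbb{R})$ that is $\mathrm{PGL}_3(\mathbb{C})$-conjugate to $G$; $G$ descends to $\mathbb{R}$ (is definable over $\mathbb{R}$) if such a model exists. *)

(* Defs.v *)
From HB Require Import structures.
From mathcomp Require Import all_boot all_order all_algebra all_fingroup all_solvable.
From mathcomp Require Import generic_quotient complex.
From mathcomp Require Import boolp classical_sets reals topology normedtype trigo.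

Set Implicit Arguments.
Unset Strict Implicit.
Unset Printing Implicit Defensive.

Import Order.TTheory GRing.Theory Num.Theory.

Local Open Scope ring_scope.
Local Open Scope quotient_scope.

Section GeneralLinear.
Variables (n : nat) (F : fieldType).

Record GL := MkGL { GLval : 'M[F]_n; GLvalP : GLval \in unitmx }.

HB.instance Definition _ := [isSub for GLval].
HB.instance Definition _ := [Choice of GL by <:].

Fact GL1_subproof : (1%:M : 'M[F]_n) \in unitmx.
Proof. exact: unitmx1. Qed.

Fact GLmul_subproof (A B : GL) : GLval A *m GLval B \in unitmx.
Proof. by rewrite unitmx_mul !GLvalP. Qed.

Fact GLinv_subproof (A : GL) : invmx (GLval A) \in unitmx.
Proof. by rewrite unitmx_inv GLvalP. Qed.

Definition GL1 : GL := MkGL GL1_subproof.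
Definition GLmul (A B : GL) : GL := MkGL (GLmul_subproof A B).
Definition GLinv (A : GL) : GL := MkGL (GLinv_subproof A).

Fact GLmulA : associative GLmul.
Proof. by move=> A B C; apply: val_inj; rewrite /= mulmxA. Qed.
Fact GLmul1 : left_id GL1 GLmul.
Proof. by move=> A; apply: val_inj; rewrite /= mul1mx. Qed.
Fact GLmulr1 : right_id GL1 GLmul.
Proof. by move=> A; apply: val_inj; rewrite /= mulmx1. Qed.
Fact GLmulV : left_inverse GL1 GLinv GLmul.
Proof. by move=> A; apply: val_inj; rewrite /= mulVmx ?GLvalP. Qed.
Fact GLmulVr : right_inverse GL1 GLinv GLmul.
Proof. by move=> A; apply: val_inj; rewrite /= mulmxV ?GLvalP. Qed.

HB.instance Definition _ :=
  isGroup.Build GL GLmulA GLmul1 GLmulr1 GLmulV GLmulVr.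

Definition proportional (A B : GL) : bool :=
  `[< exists2 c : F, c != 0 & GLval A = c *: GLval B >].

Fact proportional_refl : reflexive proportional.
Proof. by move=> A; apply/asboolP; exists 1; rewrite ?oner_eq0 ?scale1r. Qed.

Fact proportional_sym : symmetric proportional.
Proof.
suff H A B : proportional A B -> proportional B A.
  by move=> A B; apply/idP/idP; apply: H.
move=> /asboolP[c c0 AB]; apply/asboolP; exists c^-1; first by rewrite invr_eq0.
by rewrite AB scalerA mulVf // scale1r.
Qed.

Fact proportional_trans : transitive proportional.
Proof.
move=> B A C /asboolP[c c0 AB] /asboolP[d d0 BC]; apply/asboolP.
by exists (c * d); [rewrite mulf_neq0 | rewrite AB BC scalerA].
Qed.

Canonical proportional_equiv :=
  EquivRel proportional proportional_refl proportional_sym proportional_trans.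

Definition PGL := {eq_quot proportional_equiv}.
HB.instance Definition _ := Choice.on PGL.
HB.instance Definition _ := EqQuotient.on PGL.

Definition GLclass (A : GL) : PGL := \pi_PGL A.

Lemma GLclassP (A B : GL) :
  GLclass A = GLclass B <-> exists2 c : F, c != 0 & GLval A = c *: GLval B.
Proof.
by split=> [/eqmodP/asboolP|H] //; apply/eqmodP/asboolP.
Qed.

Lemma GLclass_repr (x : PGL) : GLclass (repr x) = x.
Proof. exact: reprK. Qed.

Definition PGL1 : PGL := GLclass 1%g.
Definition PGLmul (x y : PGL) : PGL := GLclass (repr x * repr y)%g.
Definition PGLinv (x : PGL) : PGL := GLclass (repr x)^-1%g.

Lemma PGLmulE (A B : GL) : PGLmul (GLclass A) (GLclass B) = GLclass (A * B)%g.
Proof.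
have /GLclassP[c c0 cA] := GLclass_repr (GLclass A).
have /GLclassP[d d0 dB] := GLclass_repr (GLclass B).
apply/GLclassP; exists (c * d); first by rewrite mulf_neq0.
by rewrite /= cA dB -scalemxAl -scalemxAr scalerA.
Qed.

Lemma PGLinvE (A : GL) : PGLinv (GLclass A) = GLclass A^-1%g.
Proof.
have /GLclassP[c c0 cA] := GLclass_repr (GLclass A).
apply/GLclassP; exists c^-1; first by rewrite invr_eq0.
rewrite /= cA invmxZ //.
by rewrite -cA GLvalP.
Qed.

Fact PGLmulA : associative PGLmul.
Proof.
move=> x y z; rewrite -(GLclass_repr x) -(GLclass_repr y) -(GLclass_repr z).
by rewrite !PGLmulE mulgA.
Qed.
Fact PGLmul1 : left_id PGL1 PGLmul.
Proof. by move=> x; rewrite -(GLclass_repr x) PGLmulE mul1g. Qed.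
Fact PGLmulr1 : right_id PGL1 PGLmul.
Proof. by move=> x; rewrite -(GLclass_repr x) PGLmulE mulg1. Qed.
Fact PGLmulV : left_inverse PGL1 PGLinv PGLmul.
Proof. by move=> x; rewrite -(GLclass_repr x) PGLinvE PGLmulE mulVg. Qed.
Fact PGLmulVr : right_inverse PGL1 PGLinv PGLmul.
Proof. by move=> x; rewrite -(GLclass_repr x) PGLinvE PGLmulE mulgV. Qed.

HB.instance Definition _ :=
  isGroup.Build PGL PGLmulA PGLmul1 PGLmulr1 PGLmulV PGLmulVr.

(* Class of a square matrix; the value at a singular matrix is junk (the
   identity), whence the invertibility clause of [represents] below. *)
Definition mxclass (M : 'M[F]_n) : PGL := GLclass (insubd GL1 M).

Definition represents (M : 'M[F]_n) (g : PGL) : Prop :=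
  M \in unitmx /\ g = mxclass M.

End GeneralLinear.

Arguments GL n F : clear implicits.
Arguments PGL n F : clear implicits.

Section BaseChange.
Variables (n : nat) (F K : fieldType) (f : {rmorphism F -> K}).

Fact GLmap_subproof (A : GL n F) : map_mx f (GLval A) \in unitmx.
Proof. by rewrite map_unitmx GLvalP. Qed.

Definition GLmap (A : GL n F) : GL n K := MkGL (GLmap_subproof A).

Definition PGLmap (x : PGL n F) : PGL n K := GLclass (GLmap (repr x)).

Lemma PGLmapE (A : GL n F) : PGLmap (GLclass A) = GLclass (GLmap A).
Proof.
have /GLclassP[c c0 cA] := GLclass_repr (GLclass A).
by apply/GLclassP; exists (f c); rewrite ?fmorph_eq0 //= cA map_mxZ.
Qed.

End BaseChange.

Section SubsetsOfGroups.
Local Open Scope classical_set_scope.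
Local Open Scope group_scope.
Variable T : groupType.

Definition is_subgroup (H : set T) : Prop :=
  [/\ H 1, forall x y, H x -> H y -> H (x * y) & forall x, H x -> H x^-1].

Definition gen_subgroup (S : set T) : set T := smallest is_subgroup S.

Definition conj_subsets (G H : set T) : Prop :=
  exists g : T, H = [set g^-1 * x * g | x in G].

(* G is the image of an injective morphism from the abstract dihedral group
   of order 2n, hence in particular a subgroup. *)
Definition is_dihedral (n : nat) (G : set T) : Prop :=
  exists f : 'D_(n.*2) -> T,
    [/\ {morph f : x y / x * y}, injective f & range f = G].

End SubsetsOfGroups.

Section RealModels.
Local Open Scope classical_set_scope.
Variables (n : nat) (R : realType).

(* PGL_n(R) is viewed inside PGL_n(C) through base change. *)
Definition real_model (H G : set (PGL n R[i])) : Prop :=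
  [/\ is_subgroup H, H `<=` range (@PGLmap n R R[i] (real_complex R))
    & conj_subsets G H].

Definition descends_to_R (G : set (PGL n R[i])) : Prop :=
  exists H : set (PGL n R[i]), real_model H G.

End RealModels.

Definition mx3 (F : fieldType) (rows : seq (seq F)) : 'M[F]_3 :=
  \matrix_(i, j) nth 0 (nth [::] rows i) j.

Section Dihedral.
Variable R : realType.
Local Notation C := R[i].
Local Notation Re := complex.Re.
Local Notation Im := complex.Im.
Local Open Scope complex_scope.

Definition zeta (n : nat) : C :=
  cos (2 * pi / n%:R) +i* sin (2 * pi / n%:R).

Definition Bmx : 'M[C]_3 :=
  mx3 [:: [:: 1; 0; 0];
          [:: 0; 0; 1];
          [:: 0; 1; 0]].

Definition Amx (n : nat) (a : int) : 'M[C]_3 :=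
  mx3 [:: [:: 1; 0;          0            ];
          [:: 0; zeta n ^ a; 0            ];
          [:: 0; 0;          zeta n ^ (- a)]].

Definition phimx (alpha beta : C) : 'M[C]_3 :=
  mx3 [:: [:: 1; 0;        0      ];
          [:: 0; alpha;    beta   ];
          [:: 0; alpha^*;  beta^* ]].

Definition real_Amx (n : nat) (a : int) (alpha beta : C) : 'M[R]_3 :=
  let s := sin (2 * pi * a%:~R / n%:R) in
  mx3 [:: [:: 2 * Im (alpha * beta^*); 0; 0];
          [:: 0; 2 * Im (alpha * beta^* * zeta n ^ a);
                 2 * (Re `|beta|) ^+ 2 * s];
          [:: 0; - 2 * (Re `|alpha|) ^+ 2 * s;
                 2 * Im (alpha * beta^* * zeta n ^ (- a))]].

Definition real_Bmx (alpha beta : C) : 'M[R]_3 :=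
  mx3 [:: [:: 2 * Im (alpha * beta^*); 0; 0];
          [:: 0; - 2 * Im (alpha * beta); - 2 * Im (beta ^+ 2)];
          [:: 0; 2 * Im (alpha ^+ 2); 2 * Im (alpha * beta)]].

Lemma unitmx_Bmx : Bmx \in unitmx.
Proof.
suff H : Bmx *m Bmx = 1%:M by case: (mulmx1_unit H).
apply/matrixP => i j; rewrite !mxE !big_ord_recr big_ord0 /= !mxE /=.
by case: i => [[|[|[|]]] ?] //; case: j => [[|[|[|]]] ?] //=;
   rewrite ?(mul0r, mulr0, mul1r, addr0, add0r).
Qed.

Lemma zeta_neq0 n : zeta n != 0.
Proof.
apply/eqP => -[c0 s0]; have := cos2Dsin2 (2 * pi / n%:R : R).
by rewrite c0 s0 expr0n addr0 => /eqP; rewrite eq_sym oner_eq0.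
Qed.

Lemma unitmx_Amx n a : Amx n a \in unitmx.
Proof.
suff H : Amx n a *m Amx n (- a) = 1%:M by case: (mulmx1_unit H).
have Z b : zeta n ^ b * zeta n ^ (- b) = 1.
  by rewrite -expfzDr ?zeta_neq0 // subrr expr0z.
apply/matrixP => i j; rewrite !mxE !big_ord_recr big_ord0 /= !mxE /=.
by case: i => [[|[|[|]]] ?] //; case: j => [[|[|[|]]] ?] //=;
   rewrite ?(mul0r, mulr0, mul1r, addr0, add0r) ?Z.
Qed.

End Dihedral.

(* Main.v *)
Require Import Defs.
From mathcomp Require Import all_boot all_order all_algebra all_fingroup.
From mathcomp Require Import all_solvable.
From mathcomp Require Import complex ring lra.
From mathcomp Require Import boolp classical_sets reals trigo.

(** Let x, y generate the dihedral group, with x of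
order n, y an involution and x y x = y.  The decisive point is that the
relations lift to matrices without any projective ambiguity
([dihedral_lift]): over an algebraically closed field the lift Y can be scaled
so that Y Y = 1, the lift X so that X Y X = Y holds exactly, and since the
dimension 3 is odd the remaining sign of X can be used to make det X = 1,
which then forces X ^+ n = 1.

From X Y X = Y, det X = 1 and odd dimension, 1 is an eigenvalue of X
([eigenvalue1_of_inverted]); from X ^+ n = 1 and X ^+ 2 != 1, which holds
because n >= 3, X is diagonalizable and has an eigenvalue z with z ^+ 2 != 1
([exists_eigenvalue_sqr_neq1]).  Conjugation by Y inverts X, hence Y sends
a z-eigenvector to a z^-1-eigenvector and preserves the 1-eigenspace.  In the
basis made of a common eigenvector of X and Y, a z-eigenvector and its image
under Y, X becomes diag(1, z, z^-1) and Y becomes, up to a scalar, the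
permutation matrix B ([dihedral_pair_normal_form]).  As x has order n, so has
z, i.e. z is a primitive n-th root of unity, a power of zeta_n with exponent
prime to n.

For the descent, a matrix with rows (alpha, beta) and their conjugates has
columns fixed by the composition of complex conjugation with the exchange of
the last two coordinates.  That semilinear map commutes with A and B because
z^-1 is the conjugate of z, so that A and B become real in the new basis.
Concretely, the two displayed real matrices M satisfy
phi M = 2 Im(alpha beta^* ) N phi with N = A or B ([phimx_real_Amx],
[phimx_real_Bmx]), and phi is invertible as soon as Im(alpha beta^* ) != 0,
for instance for alpha = i and beta = 1. *)

Set Implicit Arguments.
Unset Strict Implicit.
Unset Printing Implicit Defensive.

Import Order.TTheory GRing.Theory Num.Theory.

Local Open Scope ring_scope.
Local Notation Re := complex.Re.
Local Notation Im := complex.Im.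
Local Notation GLval := Defs.GLval.

(** * Generated subgroups *)

Section GeneratedSubgroups.
Local Open Scope classical_set_scope.
Local Open Scope group_scope.

Lemma gen_subgroup_is_subgroup (T : groupType) (S : set T) :
  is_subgroup (gen_subgroup S).
Proof.
split=> [|x y Hx Hy|x Hx] H [HH SH].
- by case: HH.
- by case: (HH) => _ HM _; apply: HM; [apply: Hx | apply: Hy].
- by case: (HH) => _ _ HV; apply: HV; apply: Hx.
Qed.

Lemma sub_gen_subgroup (T : groupType) (S : set T) : S `<=` gen_subgroup S.
Proof. by move=> x Sx H [_]; apply. Qed.

Lemma gen_subgroup_min (T : groupType) (S H : set T) :
  is_subgroup H -> S `<=` H -> gen_subgroup S `<=` H.
Proof. by move=> HH SH x; apply. Qed.

Section Morphism.
Variables (T U : groupType) (h : T -> U).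
Hypothesis hM : {morph h : x y / x * y}.

Lemma morph_one : h 1 = 1.
Proof. by apply: (mulgI (h 1)); rewrite -hM !mulg1. Qed.

Lemma morph_inv : {morph h : x / x^-1}.
Proof. by move=> x; apply: (mulgI (h x)); rewrite -hM !mulgV morph_one. Qed.

Lemma image_is_subgroup (H : set T) : is_subgroup H -> is_subgroup (h @` H).
Proof.
case=> H1 HM HV; split=> [|_ _ [x Hx <-] [y Hy <-]|_ [x Hx <-]].
- by exists 1; rewrite ?morph_one.
- by exists (x * y); rewrite ?hM //; apply: HM.
- by exists x^-1; rewrite ?morph_inv //; apply: HV.
Qed.

(** Applied below both to the given embedding of the abstract dihedral group and
to conjugations. *)
Lemma image_gen_subgroup (S : set T) :
  h @` gen_subgroup S = gen_subgroup (h @` S).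
Proof.
have [G1 GM GV] := gen_subgroup_is_subgroup (h @` S).
apply/seteqP; split; last first.
  apply: gen_subgroup_min => [|_ [x Sx <-]].
    exact: image_is_subgroup (gen_subgroup_is_subgroup S).
  by exists x => //; apply: sub_gen_subgroup.
apply/image_subP; apply: gen_subgroup_min; last first.
  by move=> x Sx; apply: sub_gen_subgroup; exists x.
split=> [|x y Hx Hy|x Hx]; rewrite /preimage /mkset ?morph_one //.
  by rewrite hM; apply: GM.
by rewrite morph_inv; apply: GV.
Qed.

Lemma morph_expg k : {morph h : x / x ^+ k}.
Proof. by elim: k => [|k IHk] x; rewrite ?morph_one // !expgS hM IHk. Qed.

End Morphism.

Lemma conj_gen_subgroup (T : groupType) (x y g : T) :
  conj_subsets (gen_subgroup [set x; y])
               (gen_subgroup [set g^-1 * x * g; g^-1 * y * g]).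
Proof.
exists g; rewrite image_gen_subgroup ?image_setU ?image_set1 //.
by move=> u v; rewrite !mulgA mulgK.
Qed.

Lemma conj_subsets_trans (T : groupType) (G H K : set T) :
  conj_subsets G H -> conj_subsets H K -> conj_subsets G K.
Proof.
case=> g -> [k ->]; exists (g * k); rewrite image_comp; congr image.
by apply/funext => x /=; rewrite invgM !mulgA.
Qed.

End GeneratedSubgroups.

(** * Generators of the dihedral groups *)

Section DihedralGroups.
Local Open Scope group_scope.

(** Bridges the two ways of generating a finite group: a predicate closed under
products that contains the generators already contains their inverses. *)
Lemma gen_subgroup_join (gT : finGroupType) (x y : gT) :
  <[x]> <*> <[y]> = [set: gT] -> gen_subgroup [set x; y]%classic = setT%classic.
Proof.
move=> genT; have [G1 GM _] := gen_subgroup_is_subgroup [set x; y]%classic.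
have grp : group_set [set t : gT | `[< gen_subgroup [set x; y]%classic t >]].
  by apply/group_setP; split=> [|u v]; rewrite !inE //; apply: GM.
apply/seteqP; split=> // t _.
suff : t \in Group grp by rewrite finset.inE => /asboolP.
suff /fintype.subsetP : [set: gT] \subset Group grp by apply; rewrite finset.in_setT.
rewrite -genT join_subG !cycle_subG !finset.inE.
by apply/andP; split;
  apply/asboolP; apply: sub_gen_subgroup; [left | right].
Qed.

(** The presentation alone bounds the order of x by n; equality follows by
counting, because the n.*2 elements are all products of a power of x by a
power of y. *)
Lemma dihedral_generators (n : nat) : (1 < n)%N ->
  exists x y : 'D_(n.*2),
    [/\ <[x]> <*> <[y]> = [set: 'D_(n.*2)], #[x] = n,
        y ^+ 2 = 1 & x ^ y = x^-1].
Proof.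
move=> n_gt1; move: (Grp_dihedral n_gt1 [set: 'D_(n.*2)]%G); rewrite homg_refl.
move=> /esym/existsP[[x y] /eqP /= [genT xn1 y2 xy]].
exists x, y; split=> //; apply/eqP; rewrite eqn_leq dvdn_leq ?order_dvdn ?xn1 //.
  have : #|[set: 'D_(n.*2)]| = n.*2 by rewrite card_dihedral.
  have nxy : <[y]> \subset 'N(<[x]>).
    by rewrite cycle_subG; apply/normP; rewrite -cycleJ xy cycleV.
  rewrite -genT norm_joinEr // => card_xy.
  have y_le2 : (#[y] <= 2)%N by rewrite dvdn_leq // order_dvdn y2.
  rewrite -leq_double; apply: leq_trans (eq_leq (esym card_xy)) _.
  rewrite -(muln2 #[x]); apply: leq_trans (leq_mul (leqnn #[x]) y_le2).
  by rewrite !orderE mul_cardG leq_pmulr ?cardG_gt0.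
exact: ltnW.
Qed.

End DihedralGroups.

(** * Pairs of 3 x 3 matrices generating a dihedral group *)

(** Eigenspaces for distinct eigenvalues are in direct sum, so no row of P lies
in the span of the others. *)
Lemma row_free_eigenvectors (F : fieldType) (m n : nat) (X : 'M[F]_n)
    (P : 'M_(m, n)) (d : 'I_m -> F) :
    injective d -> (forall i, row i P != 0) ->
    (forall i, row i P *m X = d i *: row i P) ->
  row_free P.
Proof.
move=> d_inj P_neq0 PX; apply: contraT; case/row_freePn=> i.
have eigP j : (row j P <= eigenspace X (d j))%MS by apply/eigenspaceP.
have /mxdirect_sumsP/(_ i isT) cap0 :=
  mxdirect_sum_eigenspace X (in2W d_inj : {in xpredT &, injective d}).
have sub : (row' i P <= \sum_(j | j != i) eigenspace X (d j))%MS.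
  apply/row_subP => j; rewrite row'Esub row_rowsub.
  apply: submx_trans (eigP _) _.
  by apply: (sumsmx_sup (lift i j)) (submx_refl _); rewrite eq_sym neq_lift.
move=> /submx_trans/(_ sub) le_i.
by have := P_neq0 i; rewrite -submx0 -cap0 sub_capmx eigP le_i.
Qed.

(** In odd dimension (X - 1) Y X = - Y (X - 1) yields
det (X - 1) = - det (X - 1). *)
Lemma eigenvalue1_of_inverted (F : fieldType) (n : nat) (X Y : 'M[F]_n) :
    odd n -> 2%:R != 0 :> F -> Y \in unitmx -> \det X = 1 ->
    X *m Y *m X = Y ->
  eigenvalue X 1.
Proof.
move=> odd_n two_neq0 Yu detX XYX.
have E : (X - 1%:M) *m Y *m X = - (Y *m (X - 1%:M)).
  by rewrite !mulmxBl XYX mul1mx mulmxBr mulmx1 opprB.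
have /eqP := congr1 determinant E.
rewrite -[- (Y *m _)]scaleN1r detZ !det_mulmx.
rewrite detX mulr1 mulrC -signr_odd odd_n expr1 mulN1r -addr_eq0.
rewrite -mulr2n -mulr_natl !mulf_eq0 (negPf two_neq0) /=.
rewrite unitmxE unitfE in Yu; rewrite (negPf Yu) /= => /det0P[v v_neq0 vX].
apply/eigenvalueP; exists v => //; apply/eqP.
by rewrite scale1r -subr_eq0 -{2}[v]mulmx1 -mulmxBr vX.
Qed.

(** X is annihilated by the separable split polynomial 'X^n - 1, hence
diagonalizable; were all its eigenvalues 1 or -1, its square would be 1. *)
Lemma exists_eigenvalue_sqr_neq1 (F : fieldType) (k n : nat) (w : F)
    (X : 'M[F]_k.+1) :
    n.-primitive_root w -> X ^+ n = 1 -> X ^+ 2 != 1 ->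
  exists2 z, eigenvalue X z & z ^+ 2 != 1.
Proof.
move=> prim_w Xn1 X2_neq1.
have : diagonalizable X.
  apply/diagonalizableP; exists [seq w ^+ i | i <- index_iota 0 n].
    rewrite map_inj_in_uniq ?iota_uniq // => i j.
    rewrite !mem_index_iota /= => lt_in lt_jn /eqP.
    by rewrite (eq_prim_root_expr prim_w) !modn_small // => /eqP.
  apply: mxminpoly_min.
  rewrite big_map factor_Xn_sub_1 //.
  by rewrite rmorphB rmorphXn /= horner_mx_X rmorph1 Xn1 subrr.
case=> P Pu /diagonalizable_forPex[d /(simmxP Pu) PX].
case: (pickP (fun i => d 0 i ^+ 2 != 1)) => [i di|d2_eq1].
  exists (d 0 i) => //; apply/eigenvalueP; exists (row i P).
    by rewrite -row_mul PX row_mul row_diag_mx -scalemxAl -rowE.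
  apply/eqP => rowP0; have : ~~ row_free P.
    by apply/row_freePn; exists i; rewrite rowP0 sub0mx.
  by rewrite row_free_unit Pu.
case/eqP: X2_neq1; rewrite expr2.
apply: (can_inj (mulKmx Pu)).
rewrite /GRing.mul /= mulmxA PX -mulmxA PX mulmxA mulmx_diag.
rewrite (_ : \row_j _ = const_mx 1) ?diag_const_mx ?mul1mx ?mulmx1 //.
by apply/rowP => i; rewrite !mxE -expr2; apply/eqP/negbFE/d2_eq1.
Qed.

Lemma row3_mulmx (F : fieldType) (p : nat) (M : 'M[F]_3) (P : 'M[F]_(3, p)) i :
  row i (M *m P) = M i 0 *: row 0 P + M i 1 *: row 1 P + M i 2 *: row 2 P.
Proof.
rewrite row_mul mulmx_sum_row !big_ord_recl big_ord0 addr0 addrA !mxE.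
have -> : lift ord0 (lift ord0 ord0) = 2 :> 'I_3 by apply: val_inj.
by have -> : lift ord0 ord0 = 1 :> 'I_3 by apply: val_inj.
Qed.

Definition rows3 (F : fieldType) (v0 v1 v2 : 'rV[F]_3) : 'M[F]_3 :=
  \matrix_i nth 0 [:: v0; v1; v2] i.

(** The scalar c is the sign by which Y acts on the chosen 1-eigenvector; it is
absorbed in PGL_3. *)
Lemma dihedral_pair_normal_form (F : fieldType) (n : nat) (w : F)
    (X Y : 'M[F]_3) :
    2%:R != 0 :> F -> n.-primitive_root w -> X ^+ n = 1 -> X ^+ 2 != 1 ->
    \det X = 1 -> Y *m Y = 1%:M -> X *m Y *m X = Y ->
  exists (P : 'M[F]_3) (z c : F),
    [/\ P \in unitmx, c != 0,
        P *m X = mx3 [:: [:: 1; 0; 0]; [:: 0; z; 0]; [:: 0; 0; z^-1]] *m P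
      & P *m Y = c *: (mx3 [:: [:: 1; 0; 0]; [:: 0; 0; 1]; [:: 0; 1; 0]] *m P)].
Proof.
move=> two_neq0 prim_w Xn1 X2_neq1 detX YY XYX.
have [_ Yu] := mulmx1_unit YY.
have Xu : X \in unitmx by rewrite unitmxE detX unitr1.
(* Y preserves the 1-eigenspace of X: for v in it, either v + v Y is a nonzero
   eigenvector of Y for 1, or v itself is one for -1. *)
have [v0 [e [v0X v0Y e2 v0_neq0]]] : exists (v : 'rV_3) (e : F),
    [/\ v *m X = v, v *m Y = e *: v, e * e = 1 & v != 0].
  have /eigenvalueP[v] := (eigenvalue1_of_inverted (isT : odd 3) two_neq0 Yu detX XYX).
  rewrite scale1r => vX v_neq0; case: (eqVneq (v + v *m Y) 0) => [vY|vY].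
    exists v, (-1); split=> //; last by rewrite mulrNN mulr1.
    by apply/eqP; rewrite scaleN1r -addr_eq0 addrC vY.
  exists (v + v *m Y), 1; split=> //; last by rewrite mulr1.
    by rewrite mulmxDl vX -[in RHS]XYX !mulmxA vX.
  by rewrite scale1r mulmxDl -mulmxA YY mulmx1 addrC.
have [z /eigenvalueP[v1 v1X v1_neq0] z2_neq1] :=
  exists_eigenvalue_sqr_neq1 prim_w Xn1 X2_neq1.
have z_neq0 : z != 0.
  apply: contra_neq v1_neq0 => z0; apply: (can_inj (mulmxK Xu)).
  by rewrite v1X z0 scale0r mul0mx.
have v1YX : v1 *m Y *m X = z^-1 *: (v1 *m Y).
  by rewrite -{2}XYX !mulmxA v1X -!scalemxAl scalerA mulVf // scale1r.
have z_neq1 : z != 1 by apply: contra_neq z2_neq1 => ->; rewrite expr1n.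
have z_neqV : z != z^-1.
  by apply: contra_neq z2_neq1 => E; rewrite expr2 {2}E mulfV.
have e_neq0 : e != 0 by apply: contra_eq_neq e2 => ->; rewrite mul0r eq_sym oner_eq0.
pose d (i : 'I_3) := nth 0 [:: 1; z; z^-1] i.
(* The factor e gives Y the same scalar on the plane as on the line of v0. *)
exists (rows3 v0 v1 (e *: (v1 *m Y))), z, e.
have rE i : row i (rows3 v0 v1 (e *: (v1 *m Y))) =
  nth 0 [:: v0; v1; e *: (v1 *m Y)] i by rewrite rowK.
split=> //.
- rewrite -row_free_unit; apply: (@row_free_eigenvectors _ _ _ X _ d).
  + have uniq_d : uniq [:: 1; z; z^-1].
      by rewrite /= !inE negb_or z_neqV ![1 == _]eq_sym invr_eq1 z_neq1.
    by move=> i j /eqP; rewrite nth_uniq ?ltn_ord // => /eqP/val_inj.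
  + move=> i; rewrite rE; case: i => [[|[|[|]]] ?] //=.
    rewrite scaler_eq0 negb_or e_neq0 /=; apply: contra_neq v1_neq0 => E.
    by rewrite -[v1]mulmx1 -YY mulmxA E mul0mx.
  + move=> i; rewrite rE /d; case: i => [[|[|[|]]] ?] //=.
      by rewrite scale1r.
    by rewrite -scalemxAl v1YX !scalerA mulrC.
- apply/row_matrixP => i; rewrite [LHS]row_mul row3_mulmx !rE !mxE /=.
  case: i => [[|[|[|]]] ?] //=; rewrite ?scale1r ?scale0r ?addr0 ?add0r //.
  by rewrite -scalemxAl v1YX !scalerA mulrC.
apply/row_matrixP => i; rewrite [LHS]row_mul linearZ /= row3_mulmx !rE !mxE /=.
case: i => [[|[|[|]]] ?] //=; rewrite ?scale1r ?scale0r ?addr0 ?add0r //.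
  by rewrite scalerA e2 scale1r.
by rewrite -scalemxAl -mulmxA YY mulmx1.
Qed.

Lemma mx3_diag_pow (F : fieldType) (z z' : F) (k : nat) :
  mx3 [:: [:: 1; 0; 0]; [:: 0; z; 0]; [:: 0; 0; z']] ^+ k =
  mx3 [:: [:: 1; 0; 0]; [:: 0; z ^+ k; 0]; [:: 0; 0; z' ^+ k]].
Proof.
elim: k => [|k IHk].
  apply/matrixP => i j; rewrite !mxE.
  by case: i j => [[|[|[|]]] ?] // [[|[|[|]]] ?].
rewrite exprS IHk; apply/matrixP => i j.
rewrite !mxE !big_ord_recr big_ord0 /= !mxE /=.
case: i j => [[|[|[|]]] ?] // [[|[|[|]]] ?] //=;
  by rewrite ?(mul0r, mulr0, mul1r, addr0, add0r) ?exprS.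
Qed.

Lemma similar_diag_pow_eq1 (F : fieldType) (P X : 'M[F]_3) (z : F) (k : nat) :
    P \in unitmx ->
    P *m X = mx3 [:: [:: 1; 0; 0]; [:: 0; z; 0]; [:: 0; 0; z^-1]] *m P ->
  X ^+ k = 1 <-> z ^+ k = 1.
Proof.
set D := mx3 _ => Pu PX.
have PXk : P *m X ^+ k = D ^+ k *m P.
  elim: k => [|k IHk]; first by rewrite mulmx1 mul1mx.
  by rewrite [X ^+ _]exprS [D ^+ _]exprS -!mulmxE mulmxA PX -mulmxA IHk mulmxA.
split=> [Xk1|zk1].
  have : D ^+ k = 1%:M by rewrite -[LHS](mulmxK Pu) -PXk Xk1 mulmx1 mulmxV.
  move=> /matrixP/(_ 1 1).
  by rewrite mx3_diag_pow !mxE.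
apply: (can_inj (mulKmx Pu)); rewrite PXk mx3_diag_pow exprVn zk1 invr1.
rewrite mulmx1 (_ : mx3 _ = 1%:M) ?mul1mx //; apply/matrixP => i j; rewrite !mxE.
by case: i j => [[|[|[|]]] ?] // [[|[|[|]]] ?].
Qed.

(** * Primitivity of zeta_n *)

Section RootsOfUnity.
Variable R : realType.
Local Open Scope complex_scope.

Lemma de_moivre (t : R) (k : nat) :
  (cos t +i* sin t) ^+ k = cos (t *+ k) +i* sin (t *+ k).
Proof.
elim: k => [|k IHk]; first by rewrite !mulr0n cos0 sin0.
rewrite exprS IHk mulrS cosD sinD; apply/eqP; rewrite eq_complex /=.
by rewrite [_ + cos t * _]addrC ?[sin t * _]mulrC !eqxx.
Qed.

(** Half-angle formula: cos t = 1 - 2 sin(t/2)^2 with sin(t/2) > 0. *)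
Lemma cos_lt1 (t : R) : 0 < t < 2 * pi -> cos t < 1.
Proof.
move=> /andP[t_gt0 t_lt2pi].
have -> : t = (t / 2) *+ 2 by rewrite -mulr_natr divfK ?pnatr_eq0.
rewrite cos_mulr2n cos2sin2.
have : 0 < sin (t / 2).
  by apply: sin_gt0_pi; rewrite divr_gt0 //= ltr_pdivrMr // mulrC.
move=> /(exprn_gt0 2) s2.
by lra.
Qed.

Lemma zeta_prim_root (n : nat) : (0 < n)%N -> n.-primitive_root (zeta R n).
Proof.
move=> n_gt0; have n_neq0 : n%:R != 0 :> R by rewrite pnatr_eq0 -lt0n.
have zX k : zeta R n ^+ k = 1 -> cos (2 * pi / n%:R *+ k) = 1 :> R.
  by rewrite /zeta de_moivre => -[].
apply/andP; split=> //; apply/forallP => -[k lt_kn] /=; apply/eqP.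
rewrite unity_rootE.
case: (eqVneq k.+1 n) => [-> | neq_kn].
  rewrite /zeta de_moivre -[_ *+ n]mulr_natr divfK // mulrC mulr_natr cos2pi.
  by rewrite -[pi *+ 2]add0r sinD2pi sin0 eqxx.
apply/eqP => /zX E.
suff : cos (2 * pi / n%:R *+ k.+1) < 1 :> R by rewrite E ltxx.
apply: cos_lt1; rewrite pmulrn_lgt0 // divr_gt0 ?mulr_gt0 ?pi_gt0 ?ltr0n //=.
rewrite -[_ *+ k.+1]mulr_natr mulrAC ltr_pdivrMr ?ltr0n //
  ltr_pM2l ?mulr_gt0 ?pi_gt0 //.
by rewrite ltr_nat ltn_neqAle neq_kn lt_kn.
Qed.

End RootsOfUnity.

(** * The real forms of A and B *)

Section RealForms.
Variable R : realType.
Local Open Scope complex_scope.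
Implicit Types alpha beta : R[i].

Lemma zeta_exp (n k : nat) :
  let t := 2 * pi * k%:R / n%:R in
  zeta R n ^ k%:Z = cos t +i* sin t /\ zeta R n ^ (- k%:Z) = cos t -i* sin t.
Proof.
move=> t.
have E : zeta R n ^+ k = cos t +i* sin t.
  by rewrite /zeta de_moivre -[_ *+ k]mulr_natr mulrAC.
split; first exact: E.
rewrite -invr_expz -exprnP E.
have nz : cos t +i* sin t != 0 by rewrite -E expf_neq0 ?zeta_neq0.
apply: (mulfI nz); rewrite mulfV //.
apply/eqP; rewrite eq_complex /=; apply/andP; split; apply/eqP; last by ring.
by rewrite -(cos2Dsin2 t); ring.
Qed.

Lemma sqr_Re_norm (z : R[i]) : Re `|z| ^+ 2 = Re z ^+ 2 + Im z ^+ 2.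
Proof. by rewrite normc_def /= sqr_sqrtr // addr_ge0 ?sqr_ge0. Qed.

(** No trigonometric identity is involved: the equality holds entrywise as a
polynomial identity in cos t, sin t and the real and imaginary parts of alpha
and beta. *)
Lemma phimx_real_Amx (n k : nat) alpha beta :
  phimx alpha beta *m map_mx (real_complex R) (real_Amx n k%:Z alpha beta) =
  (2 * Im (alpha * beta^*))%:C *: (Amx R n k%:Z *m phimx alpha beta).
Proof.
have [zE zVE] := zeta_exp n k.
apply/matrixP => i j.
rewrite !mxE !big_ord_recr !big_ord0 /= !mxE /=.
rewrite !sqr_Re_norm zE zVE -pmulrn.
set t := 2 * pi * _ / _.
case: alpha beta => [p q] [r s].
by case: i => [[|[|[|]]] ?] //; case: j => [[|[|[|]]] ?] //=;
   apply/eqP; rewrite eq_complex /=; apply/andP; split; apply/eqP; ring.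
Qed.

Lemma phimx_real_Bmx alpha beta :
  phimx alpha beta *m map_mx (real_complex R) (real_Bmx alpha beta) =
  (2 * Im (alpha * beta^*))%:C *: (Bmx R *m phimx alpha beta).
Proof.
apply/matrixP => i j.
rewrite !mxE !big_ord_recr !big_ord0 /= !mxE /=.
case: alpha beta => [p q] [r s].
by case: i => [[|[|[|]]] ?] //; case: j => [[|[|[|]]] ?] //=;
   apply/eqP; rewrite eq_complex /=; apply/andP; split; apply/eqP; ring.
Qed.

Lemma unitmx_phimx alpha beta :
  Im (alpha * beta^*) != 0 -> phimx alpha beta \in unitmx.
Proof.
move=> im_neq0; pose c : R[i] := 0 +i* (2 * Im (alpha * beta^*)).
have c_neq0 : c != 0 by rewrite eq_complex /= eqxx mulf_neq0 ?pnatr_eq0.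
(* c is the determinant of phi and N its adjugate. *)
pose N := mx3 [:: [:: c; 0; 0]; [:: 0; beta^*; - beta]; [:: 0; - alpha^*; alpha]].
suff E : phimx alpha beta *m (c^-1 *: N) = 1%:M by case: (mulmx1_unit E).
rewrite -scalemxAr; apply: (canLR (scalerK c_neq0)); rewrite {}/N {c_neq0 im_neq0}/c.
apply/matrixP => i j; rewrite !mxE !big_ord_recr !big_ord0 /= !mxE /=.
case: alpha beta => [p q] [r s].
by case: i => [[|[|[|]]] ?] //; case: j => [[|[|[|]]] ?] //=;
   apply/eqP; rewrite eq_complex /=; apply/andP; split; apply/eqP; ring.
Qed.

End RealForms.

(** * Matrices representing elements of PGL_n *)

Section Representatives.
Variables (n : nat) (F : fieldType).
Implicit Types (M N Q : 'M[F]_n) (g h : PGL n F).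

Lemma represents_GLclass (A : GL n F) : represents (GLval A) (GLclass A).
Proof. by split; [exact: GLvalP | rewrite /mxclass (valKd _ A)]. Qed.

Lemma represents_GLclassP M g :
  represents M g -> exists2 A : GL n F, GLval A = M & g = GLclass A.
Proof.
case=> Mu ->; exists (MkGL Mu) => //.
by rewrite /mxclass; congr GLclass; apply: val_inj; rewrite val_insubd Mu.
Qed.

Lemma represents_mxclass M : M \in unitmx -> represents M (mxclass M).
Proof. by []. Qed.

Lemma exists_represents g : exists M, represents M g.
Proof.
by rewrite -(GLclass_repr g); eexists; apply: represents_GLclass.
Qed.

Lemma represents_scale M N g c :
  c != 0 -> M = c *: N -> represents N g -> represents M g.
Proof.
move=> c_neq0 -> /represents_GLclassP[A <- ->].
have cAu : c *: GLval A \in unitmx by rewrite unitmxZ ?unitfE ?GLvalP.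
suff -> : GLclass A = GLclass (MkGL cAu) by exact: (represents_GLclass (MkGL cAu)).
by apply/GLclassP; exists c^-1; rewrite ?invr_eq0 //= scalerA mulVf ?scale1r.
Qed.

Lemma represents_proportional M N g :
  represents M g -> represents N g -> exists2 c : F, c != 0 & M = c *: N.
Proof.
move=> /represents_GLclassP[A <- ->] /represents_GLclassP[B <- /GLclassP[c c0 AB]].
by exists c.
Qed.

Lemma represents1 : represents 1%:M (1%g : PGL n F).
Proof. exact: (represents_GLclass 1%g). Qed.

Lemma representsM M N g h :
  represents M g -> represents N h -> represents (M *m N) (g * h)%g.
Proof.
move=> /represents_GLclassP[A <- ->] /represents_GLclassP[B <- ->].
by rewrite [(_ * _)%g]PGLmulE; exact: (represents_GLclass (A * B)%g).
Qed.

(** Turns an intertwining relation between matrices, known up to a scalar, into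
a conjugation in PGL_n; the invertibility of M comes for free. *)
Lemma represents_conj M N Q g h c : c != 0 -> Q *m M = c *: (N *m Q) ->
  represents N g -> represents Q h -> represents M (h^-1 * g * h)%g.
Proof.
move=> c_neq0 QM Ng Qh; have [[Nu _] [Qu _]] := (Ng, Qh).
have Mu : M \in unitmx.
  have : Q *m M \in unitmx by rewrite QM unitmxZ ?unitfE // unitmx_mul Nu.
  by rewrite unitmx_mul => /andP[].
suff -> : (h^-1 * g * h)%g = mxclass M by [].
have [_ E] := represents_scale c_neq0 QM (representsM Ng Qh).
have [_ E'] := representsM Qh (represents_mxclass Mu).
by rewrite -mulgA E -E' mulKg.
Qed.

End Representatives.

Lemma representsX (n : nat) (F : fieldType) (M : 'M[F]_n.+1) (g : PGL n.+1 F) k :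
  represents M g -> represents (M ^+ k) (g ^+ k)%g.
Proof.
move=> Mg; elim: k => [|k IHk]; first exact: represents1.
by rewrite exprS expgS; apply: representsM.
Qed.

Section BaseChange.
Variables (n : nat) (F K : fieldType) (f : {rmorphism F -> K}).

Lemma PGLmapM : {morph @PGLmap n F K f : x y / (x * y)%g}.
Proof.
move=> x y; rewrite -(GLclass_repr x) -(GLclass_repr y).
rewrite [in LHS]/mulg/= [in RHS]/mulg /=.
rewrite PGLmulE !PGLmapE PGLmulE; congr GLclass.
by apply: val_inj; rewrite /= map_mxM.
Qed.

Lemma range_PGLmap (M : 'M[F]_n) (g : PGL n K) :
  represents (map_mx f M) g -> range (@PGLmap n F K f) g.
Proof.
case=> fMu ->; have Mu : M \in unitmx by rewrite map_unitmx in fMu.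
exists (mxclass M) => //.
have [A defM ->] := represents_GLclassP (represents_mxclass Mu).
have [B defB ->] := represents_GLclassP (represents_mxclass fMu).
by rewrite PGLmapE; congr GLclass; apply: val_inj; rewrite /= defM defB.
Qed.

End BaseChange.

(** * The dihedral groups in PGL_3 *)

(** Writing Y0 Y0 = u and X0 Y0 X0 = v Y0 for arbitrary lifts, one divides Y0 by
a square root of u and X0 by one of v.  Then det X is 1 or -1, and multiplying
X by its own determinant makes it 1 because the dimension is odd. *)
Lemma dihedral_lift (F : numClosedFieldType) (n : nat) (x y : PGL 3 F) :
    (x ^+ n = 1)%g -> (y ^+ 2 = 1)%g -> (x * y * x = y)%g ->
  exists X Y : 'M[F]_3,
    [/\ represents X x, represents Y y, X ^+ n = 1, \det X = 1
      & Y *m Y = 1%:M /\ X *m Y *m X = Y].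
Proof.
move=> xn1 y2 xyx.
have [Y0 Y0y] := exists_represents y; have [X0 X0x] := exists_represents x.
have [u u_neq0 YY0] : exists2 u, u != 0 & Y0 *m Y0 = u *: 1%:M.
  have := representsM Y0y Y0y; rewrite -[(y * y)%g]/(y ^+ 2)%g y2 => YY.
  exact: represents_proportional YY (represents1 _ _).
have [v v_neq0 XYX0] : exists2 v, v != 0 & X0 *m Y0 *m X0 = v *: Y0.
  have := representsM (representsM X0x Y0y) X0x; rewrite xyx => XYX.
  exact: represents_proportional XYX Y0y.
have inv_sqrt (c : F) : c != 0 -> exists2 s, s != 0 & s * s * c = 1.
  move=> c_neq0; exists (sqrtC c)^-1; first by rewrite invr_eq0 sqrtC_eq0.
  by rewrite -invfM -expr2 sqrtCK mulVf.
have [[s s_neq0 s2v] [t t_neq0 t2u]] := (inv_sqrt _ v_neq0, inv_sqrt _ u_neq0).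
pose Y := t *: Y0; pose X1 := s *: X0.
have Yy : represents Y y by apply: represents_scale t_neq0 _ Y0y.
have YY : Y *m Y = 1%:M.
  by rewrite -scalemxAl -scalemxAr YY0 !scalerA t2u scale1r.
have X1YX1 : X1 *m Y *m X1 = Y.
  rewrite -[X1 *m Y]scalemxAl -scalemxAl -!scalemxAr -scalemxAl XYX0 !scalerA.
  by rewrite mulrA mulrAC s2v mul1r.
have detY_neq0 : \det Y != 0 by rewrite -unitfE -unitmxE; case: Yy.
have detX1 : \det X1 * \det X1 = 1.
  have := congr1 determinant X1YX1; rewrite !det_mulmx mulrAC.
  by rewrite -{2}[\det Y]mul1r => /(mulIf detY_neq0).
have dX1_neq0 : \det X1 != 0.
  by apply: contra_eq_neq detX1 => ->; rewrite mul0r eq_sym oner_eq0.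
pose X := \det X1 *: X1.
have XYX : X *m Y *m X = Y.
  by rewrite -[X *m Y]scalemxAl -scalemxAl -scalemxAr scalerA detX1 X1YX1 scale1r.
have detX : \det X = 1.
  by rewrite detZ !exprS expr0 mulr1 mulrA detX1 mul1r.
have Xx : represents X x.
  by apply: represents_scale dX1_neq0 _ (represents_scale s_neq0 _ X0x).
exists X, Y; split=> //.
(* X ^+ n is a scalar c; c ^+ 2 = 1 since Y inverts it and c ^+ 3 = 1 since its
   determinant is 1. *)
have [c c_neq0 Xnc] : exists2 c, c != 0 & X ^+ n = c *: 1%:M.
  have := representsX n Xx; rewrite xn1 => Xn.
  exact: represents_proportional Xn (represents1 _ _).
have XnYXn k : X ^+ k *m Y *m X ^+ k = Y.
  elim: k => [|k IHk]; first by rewrite mul1mx mulmx1.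
  by rewrite {1}exprSr exprS -!mulmxE -[RHS]IHk -[in RHS]XYX !mulmxA.
have c2 : c * c = 1.
  have := XnYXn n; rewrite Xnc -!scalemxAl -scalemxAr mul1mx mulmx1 scalerA.
  move=> /eqP; rewrite -subr_eq0 -{2}[Y]scale1r -scalerBl.
  rewrite scaler_eq0 subr_eq0 => /orP[/eqP //|/eqP Y0'].
  by rewrite Y0' det0 eqxx in detY_neq0.
have c3 : c ^+ 3 = 1.
  have detXn : \det (X ^+ n) = 1.
    elim: (n) => [|k IHk]; first exact: det1.
    by rewrite exprS -mulmxE det_mulmx detX IHk mulr1.
  by have := congr1 determinant Xnc; rewrite detXn detZ det1 mulr1 => <-.
suff c1 : c = 1 by rewrite Xnc c1 scale1r.
by rewrite -c3 !exprS expr0 mulr1 c2 mulr1.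
Qed.

Theorem theorem2p4 (R : realType) (n : nat) (hn : (3 <= n)%N)
    (G : set (PGL 3 R[i])) (hG : is_dihedral n G) :
  exists a : int,
    let B : PGL 3 R[i] := mxclass (Bmx R) in
    let A : PGL 3 R[i] := mxclass (Amx R n a) in
    [/\ coprimez n%:Z a,
        conj_subsets G (gen_subgroup [set B; A]%classic),
        descends_to_R G
      & exists (alpha beta : R[i]) (phi : PGL 3 R[i]),
          [/\ alpha != 0%R /\ beta != 0%R,
              represents (phimx alpha beta) phi,
              real_model
                (gen_subgroup [set phi^-1 * B * phi; phi^-1 * A * phi]%classic)%g G,
              represents (map_mx (real_complex R) (real_Amx n a alpha beta))
                (phi^-1 * A * phi)%g
            & represents (map_mx (real_complex R) (real_Bmx alpha beta))
                (phi^-1 * B * phi)%g]].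
Proof.
have [x [y [genT ox y2 xy]]] := dihedral_generators (ltnW hn).
have [f [fM f_inj <-{G hG}]] := hG.
have fX k := morph_expg fM k.
have -> : range f = gen_subgroup [set f y; f x]%classic.
  by rewrite -(gen_subgroup_join genT) image_gen_subgroup // image_setU !image_set1 setUC.
have f1 : f 1%g = 1%g := morph_one fM.
have xn1 : (x ^+ n = 1)%g by apply/eqP; rewrite -order_dvdn ox.
have xyx : (x * y * x = y)%g.
  by rewrite [(x * y)%g]conjgC xy mulgKV.
have [X [Y [Xx Yy Xn1 detX [YY XYX]]]] : exists X Y : 'M[R[i]]_3,
    [/\ represents X (f x), represents Y (f y), X ^+ n = 1, \det X = 1
      & Y *m Y = 1%:M /\ X *m Y *m X = Y].
  by apply: dihedral_lift; rewrite -?fX -?fM ?xn1 ?y2 ?xyx.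
have X_order k : X ^+ k = 1 -> (n %| k)%N.
  move=> Xk1; suff : (#[x]%g %| k)%N by rewrite ox.
  rewrite order_dvdn; apply/eqP/f_inj.
  have [_] := representsX k Xx; rewrite -fX f1 => ->; rewrite Xk1.
  by have [_ ->] := represents1 3 R[i].
have X2_neq1 : X ^+ 2 != 1.
  by apply/eqP => /X_order /dvdn_leq-/(_ isT); rewrite leqNgt hn.
have n_gt0 : (0 < n)%N by apply: leq_trans hn.
have zeta_prim := zeta_prim_root R n_gt0.
have two_neq0 : 2 != 0 :> R[i] by rewrite pnatr_eq0.
have [P [z [c [Pu c_neq0 PX PY]]]] :=
  dihedral_pair_normal_form two_neq0 zeta_prim Xn1 X2_neq1 detX YY XYX.
have zX_eq1 k : X ^+ k = 1 <-> z ^+ k = 1 := similar_diag_pow_eq1 k Pu PX.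
have zn1 : z ^+ n = 1 by apply/zX_eq1.
(* z ^+ k = 1 forces X ^+ k = 1, hence x ^+ k = 1 since f is injective. *)
have z_prim : n.-primitive_root z.
  apply/andP; split=> //; apply/forallP => -[k lt_kn] /=; apply/eqP.
  rewrite unity_rootE; case: (eqVneq k.+1 n) => [->|]; first exact/eqP.
  apply: contraNF => /eqP/zX_eq1/X_order/dvdn_leq-/(_ isT) le_nk.
  by rewrite eqn_leq lt_kn.
have [k zE] := prim_rootP zeta_prim zn1.
exists k%:Z => B A.
have AmxE : Amx R n k%:Z = mx3 [:: [:: 1; 0; 0]; [:: 0; z; 0]; [:: 0; 0; z^-1]].
  by rewrite zE exprnP invr_expz.
(* The rows of P are eigenvectors, so P X P^-1 = A: the conjugator is P^-1. *)
pose g := mxclass (invmx P).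
have gP : represents (invmx P) g by apply: represents_mxclass; rewrite unitmx_inv.
have AE : A = (g^-1 * f x * g)%g.
  have [] // := represents_conj (oner_neq0 _) (M := Amx R n k%:Z) _ Xx gP.
  by rewrite scale1r AmxE -[LHS](mulmxK Pu) -(mulmxA _ _ P) -PX mulKmx.
have BE : B = (g^-1 * f y * g)%g.
  have cV_neq0 : c^-1 != 0 by rewrite invr_eq0.
  have [] // := represents_conj cV_neq0 (M := Bmx R) _ Yy gP.
  apply: (canRL (scalerK c_neq0)); rewrite -[LHS](mulmxK Pu) -!scalemxAl.
  by rewrite -(mulmxA _ _ P) scalemxAl scalemxAr /Bmx -PY mulKmx.
have conjG : conj_subsets (gen_subgroup [set f y; f x]%classic)
    (gen_subgroup [set B; A]%classic).
  by rewrite AE BE; apply: conj_gen_subgroup.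
(* Any two complex numbers independent over the reals would do. *)
pose alpha : R[i] := (0 +i* 1)%C; pose beta : R[i] := (1 +i* 0)%C.
have im1 : Im (alpha * beta^*%C) = 1.
  by rewrite /alpha /beta /=; ring.
have im_neq0 : Im (alpha * beta^*%C) != 0 by rewrite im1 oner_neq0.
pose phi := mxclass (phimx alpha beta).
have phiP : represents (phimx alpha beta) phi.
  exact/represents_mxclass/unitmx_phimx.
have d_neq0 : (2 * Im (alpha * beta^*%C))%:C%C != 0.
  by rewrite fmorph_eq0 mulf_neq0 ?pnatr_eq0.
have AP : represents (map_mx (real_complex R) (real_Amx n k%:Z alpha beta))
    (phi^-1 * A * phi)%g.
  apply: represents_conj d_neq0 (phimx_real_Amx n k alpha beta) _ phiP.
  exact/represents_mxclass/unitmx_Amx.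
have BP : represents (map_mx (real_complex R) (real_Bmx alpha beta))
    (phi^-1 * B * phi)%g.
  apply: represents_conj d_neq0 (phimx_real_Bmx alpha beta) _ phiP.
  exact/represents_mxclass/unitmx_Bmx.
have model : real_model
    (gen_subgroup [set phi^-1 * B * phi; phi^-1 * A * phi]%classic)%g
    (gen_subgroup [set f y; f x]%classic).
  split; first exact: gen_subgroup_is_subgroup.
    apply: gen_subgroup_min => [|_ [->|->]]; last 2 first.
    - exact: range_PGLmap BP.
    - exact: range_PGLmap AP.
    by apply: image_is_subgroup => //; exact: PGLmapM.
  exact: conj_subsets_trans conjG (conj_gen_subgroup _ _ _).
split=> //.
- by rewrite coprimezE /= coprime_sym -(prim_root_exp_coprime _ zeta_prim) -zE.
- by exists (gen_subgroup [set phi^-1 * B * phi; phi^-1 * A * phi]%classic)%g.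
exists alpha, beta, phi; split=> //.
by rewrite !eq_complex /= eqxx oner_eq0.
Qed.
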